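(* Let $k\geq2$ be an integer, and let $\Phi$ (fine grid, time step $h_t$) and $\Psi$ (coarse grid, time step $kh_t$) correspond to Runge--Kutta schemes with eigenvalue functions $\lambda(h_t\xi)$ and $\mu(h_t\xi)$, respectively, where $h_t\xi$ is a positive real variable. (i) If $\Psi$ corresponds to an L-stable Runge--Kutta scheme and $\Phi$ to an A-stable Runge--Kutta scheme, then \[ \lim_{h_t\xi\to \infty} \frac{|\mu(h_t\xi) - \lambda(h_t\xi)^k|}{1 - |\mu(h_t\xi)|} \leq 1, \qquad \lim_{h_t\xi\to \infty} \frac{|\lambda(h_t\xi)^k|\,|\mu(h_t\xi) - \lambda(h_t\xi)^k|}{1 - |\mu(h_t\xi)|} \leq \lim_{h_t\xi\to \infty} |\lambda(h_t\xi)^k| \leq 1. \] (ii) If both $\Psi$ and $\Phi$ correspond to L-stable Runge--Kutta schemes, then \[ \lim_{h_t\xi\to \infty} \frac{|\mu(h_t\xi) - \lambda(h_t\xi)^k|}{1 - |\mu(h_t\xi)|} = \lim_{h_t\xi\to \infty} \frac{|\lambda(h_t\xi)^k|\,|\mu(h_t\xi) - \lambda(h_t\xi)^k|}{1 - |\mu(h_t\xi)|} = 0. \]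
   Context: A Runge--Kutta scheme with $s$ stages is given by a real $s\times s$ matrix $A$ and a weight vector $\mathbf{b}\in\mathbb{R}^s$; $\mathbf{1}$ denotes the vector of ones. Its stability function is the rational function \[ R(z)=\frac{\det(I-zA+z\mathbf{1}\mathbf{b}^T)}{\det(I-zA)} = 1+z\mathbf{b}^T(I-zA)^{-1}\mathbf{1}. \] The scheme is A-stable if $|R(z)|\leq1$ for all $z\in\mathbb{C}$ with $\operatorname{Re}(z)\leq0$; it is L-stable if it is A-stable and $\lim_{|z|\to\infty}R(z)=0$. Let the fine-grid scheme be $(A_0,\mathbf{b}_0)$ with stability function $R_0$, used with time step $h_t$, and the coarse-grid scheme be $(A_1,\mathbf{b}_1)$ with stability function $R_1$, used with time step $kh_t$. Applied to $\mathbf{u}'+\mathcal{L}\mathbf{u}=f$ with $\mathcal{L}$ symmetric positive definite, the propagation operators are $\Phi=R_0(-h_t\mathcal{L})$ and $\Psi=R_1(-kh_t\mathcal{L})$, and for an eigenvalue $\xi>0$ of $\mathcal{L}$ their eigenvalues are \[ \lambda(h_t\xi)=R_0(-h_t\xi)=1-h_t\xi\,\mathbf{b}_0^T(I+h_t\xi A_0)^{-1}\mathbf{1},\qquad \mu(h_t\xi)=R_1(-kh_t\xi)=1-kh_t\xi\,\mathbf{b}_1^T(I+kh_t\xi A_1)^{-1}\mathbf{1}. \] *)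

(* Defs.v *)
From HB Require Import structures.
From mathcomp Require Import all_boot all_order all_algebra.
From mathcomp Require Import complex.
From mathcomp Require Import all_classical all_reals all_analysis.

Set Implicit Arguments.
Unset Strict Implicit.
Unset Printing Implicit Defensive.

Import Order.TTheory GRing.Theory Num.Theory.
Import numFieldNormedType.Exports.

Local Open Scope ring_scope.
Local Open Scope complex_scope.

(* The function is defined over an arbitrary field so that the same formula    *)
(* can be evaluated at complex arguments (for stability) and at real ones (for *)
(* eigenvalues).                                                               *)
Definition stability_fun (F : fieldType) (s : nat)
    (A : 'M[F]_s) (b : 'cV[F]_s) (z : F) : F :=
  \det (1%:M - z *: A + z *: (const_mx 1 *m b^T)) / \det (1%:M - z *: A).

Definition complex_stability_fun (R : realType) (s : nat)
    (A : 'M[R]_s) (b : 'cV[R]_s) (z : R[i]) : R[i] :=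
  stability_fun (map_mx (real_complex R) A) (map_mx (real_complex R) b) z.

(* Division by zero returns 0 at the finitely many zeros of det(I - zA). This  *)
(* does not change the notion: such a zero z0 with Re z0 <= 0 is a limit of    *)
(* the points z0 - t, t > 0 small, of the half-plane, so the bound at those    *)
(* points excludes a pole at z0 and, if the singularity is removable, passes   *)
(* to the true value of the rational function there.                           *)
Definition A_stable (R : realType) (s : nat)
    (A : 'M[R]_s) (b : 'cV[R]_s) : Prop :=
  forall z : R[i], complex.Re z <= 0 -> `|complex_stability_fun A b z| <= 1.

Definition vanishes_at_infinity (R : realType) (f : R[i] -> R[i]) : Prop :=
  forall e : R, 0 < e ->
    exists M : R, forall z : R[i], M%:C < `|z| -> `|f z| < e%:C.

Definition L_stable (R : realType) (s : nat)
    (A : 'M[R]_s) (b : 'cV[R]_s) : Prop :=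
  A_stable A b /\ vanishes_at_infinity (complex_stability_fun A b).

(* Below, x stands for the product of the fine time step and an eigenvalue of  *)
(* the spatial operator.                                                       *)
Definition fine_eigenvalue (R : realType) (s : nat)
    (A0 : 'M[R]_s) (b0 : 'cV[R]_s) (x : R) : R :=
  stability_fun A0 b0 (- x).

Definition coarse_eigenvalue (R : realType) (k s : nat)
    (A1 : 'M[R]_s) (b1 : 'cV[R]_s) (x : R) : R :=
  stability_fun A1 b1 (- (k%:R * x)).

(* Main.v *)
(* On the negative real axis a stability function is a quotient of
   polynomials with nonzero denominator, and A-stability bounds it by 1 there.
   A rational function bounded near +oo has numerator degree at most its
   denominator degree, hence converges. So lambda tends to some l with
   |l| <= 1, and mu to 0 by L-stability; the two quotients tend to |l|^k and
   |l|^(2k). *)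
Require Import Defs.
From HB Require Import structures.
From mathcomp Require Import all_boot all_order all_algebra.
From mathcomp Require Import complex.
From mathcomp Require Import all_classical all_reals all_analysis.

Set Implicit Arguments.
Unset Strict Implicit.
Unset Printing Implicit Defensive.

Import Order.TTheory GRing.Theory Num.Theory.
Import numFieldNormedType.Exports.

Local Open Scope classical_set_scope.
Local Open Scope ring_scope.

(** The witness is the determinant of the same pencil over [{poly F}]: evaluation at [x] is a ring
    morphism, so it commutes with [\det]. *)
Lemma exists_poly_det_affine (F : fieldType) (s : nat) (B C : 'M[F]_s) :
  exists p : {poly F}, forall x, p.[x] = \det (B + x *: C).
Proof.
exists (\det (map_mx polyC B + 'X *: map_mx polyC C)) => x.
rewrite -[LHS]/(horner_eval x _) -det_map_mx; congr (\det _).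
by apply/matrixP => i j; rewrite !mxE /= /horner_eval !hornerE.
Qed.

Lemma stability_funN_ratio (F : fieldType) (s : nat)
    (A : 'M[F]_s) (b : 'cV[F]_s) :
  exists p q : {poly F},
    q != 0 /\ forall x, stability_fun A b (- x) = p.[x] / q.[x].
Proof.
have [p pE] := exists_poly_det_affine 1%:M (A - const_mx 1 *m b^T).
have [q qE] := exists_poly_det_affine 1%:M A.
exists p, q; split=> [|x].
  (* The denominator is a nonzero polynomial because its value at 0 is the determinant of the
     identity. *)
  apply/eqP => q0; have := qE 0.
  by rewrite q0 horner0 scale0r addr0 det1 => /esym/eqP; rewrite oner_eq0.
rewrite pE qE /stability_fun !scaleNr opprK.
by rewrite scalerBr addrA.
Qed.

Section RationalAtInfinity.
Variable R : realType.

Lemma cvgVy0 : (x^-1 : R) @[x --> +oo] --> (0 : R).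
Proof.
apply/gtr0_cvgV0; last exact: cvg_id.
by apply: nbhs_pinfty_gt; exact: num_real.
Qed.

(* Away from 0, [p.[x] / x ^+ n] is the reversal of [p] evaluated at [x^-1]. *)
Lemma cvg_horner_divX (p : {poly R}) (n : nat) : (size p <= n.+1)%N ->
  p.[x] / x ^+ n @[x --> +oo] --> p`_n.
Proof.
move=> pn; pose r := \poly_(i < n.+1) p`_(n - i).
have r0 : r.[0] = p`_n by rewrite horner_coef0 coef_poly subn0.
rewrite -r0.
have rV : r.[x^-1] @[x --> +oo] --> r.[0].
  by apply: (cvg_comp _ _ cvgVy0); exact: continuous_horner.
apply: cvg_trans rV; apply: near_eq_cvg; near=> x.
have x0 : x != 0.
  by rewrite gt_eqF//; near: x; apply: nbhs_pinfty_gt; exact: num_real.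
rewrite horner_poly (horner_coef_wide _ pn) mulr_suml.
rewrite (reindex_inj rev_ord_inj); apply: eq_bigr => i _ /=.
rewrite subSS subKn; last by rewrite -ltnS.
rewrite -mulrA exprVn expfB_cond ?invf_div// (negPf x0) add0n.
by rewrite -ltnS.
Unshelve. all: by end_near. Qed.

Lemma cvg_bounded_ratio (p q : {poly R}) (M : R) : q != 0 ->
  (\forall x \near +oo, `|p.[x] / q.[x]| <= M) ->
  cvg (p.[x] / q.[x] @[x --> +oo]).
Proof.
move=> q0 bnd; set n := (size q).-1.
have sq : size q = n.+1 by rewrite prednK// lt0n size_poly_eq0.
have qn0 : q`_n != 0 by rewrite -lead_coefE lead_coef_eq0.
have cq : q.[x] / x ^+ n @[x --> +oo] --> q`_n.
  by apply: cvg_horner_divX; rewrite sq.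
have [pq|qp] := leqP (size p) (size q).
  have cp : p.[x] / x ^+ n @[x --> +oo] --> p`_n.
    by apply: cvg_horner_divX; rewrite -sq.
  (* Numerator and denominator are both divided by [x ^+ n], with [n] the degree of [q]. The
     coefficient of [p] at [n] is 0 when [p] has smaller degree. *)
  apply/cvg_ex; exists (p`_n / q`_n).
  apply: cvg_trans (cvgM cp (cvgV qn0 cq)); apply: near_eq_cvg; near=> x.
  have x0 : x ^+ n != 0.
    apply: expf_neq0; rewrite gt_eqF//; near: x; apply: nbhs_pinfty_gt.
  by rewrite /= invfM invrK mulrACA mulVf// mulr1.
(* Now the degree [m] of [p] exceeds that of [q]. Dividing [|p| <= M |q|] by [x ^+ m] and passing to
   the limit bounds the leading coefficient of [p] by [M] times a zero coefficient of [q], a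
   contradiction. *)
set m := (size p).-1.
have sp : size p = m.+1 by rewrite prednK// (leq_trans _ qp).
have p0 : p != 0 by rewrite -size_poly_eq0 sp.
have cp : `|p.[x] / x ^+ m| @[x --> +oo] --> `|p`_m|.
  by apply: cvg_norm; apply: cvg_horner_divX; rewrite sp.
have cqm : M * `|q.[x] / x ^+ m| @[x --> +oo] --> M * `|q`_m|.
  by apply: cvgMr; apply: cvg_norm; apply: cvg_horner_divX; rewrite -sp ltnW.
have : `|p`_m| <= M * `|q`_m|.
  apply: (ler_cvg_to cp cqm); near=> x.
  (* Clearing the denominator needs [q.[x]] nonzero; this holds for large [x] since [q.[x] / x ^+ n]
     has a nonzero limit. *)
  have qx : q.[x] != 0.
    suff : q.[x] / x ^+ n != 0 by apply: contra_neq => ->; rewrite mul0r.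
    by near: x; exact: (cvgr_neq0 _ cq).
  rewrite !normrM mulrA ler_wpM2r// -ler_pdivrMr ?normr_gt0//.
  by rewrite -normfV -normrM; near: x.
rewrite [q`_m]nth_default; last by rewrite -ltnS -sp.
by rewrite normr0 mulr0 normr_le0 -lead_coefE lead_coef_eq0 (negPf p0).
Unshelve. all: by end_near. Qed.

End RationalAtInfinity.

Section RealAxis.
Variables (R : realType) (s : nat) (A : 'M[R]_s) (b : 'cV[R]_s).
Local Open Scope complex_scope.

Lemma norm_real_complex (x : R) : `|x%:C| = `|x|%:C.
Proof. by rewrite normc_def /= expr0n addr0 sqrtr_sqr. Qed.

Lemma complex_stability_fun_real (x : R) :
  complex_stability_fun A b x%:C = (stability_fun A b x)%:C.
Proof.
rewrite /complex_stability_fun /stability_fun -[RHS]/(real_complex R _).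
rewrite fmorph_div -!det_map_mx map_mxD map_mxB !map_mxZ map_mxM map_trmx.
by rewrite map_mx1 map_const_mx rmorph1.
Qed.

Lemma A_stable_real (x : R) : A_stable A b -> x <= 0 ->
  `|stability_fun A b x| <= 1.
Proof.
move=> hA x0; have := hA x%:C x0.
by rewrite complex_stability_fun_real norm_real_complex -[1]/(1%:C) lecR.
Qed.

(** The bound by 1 on the negative axis serves twice: it forces the rational function to converge,
    and it passes to the limit. *)
Lemma A_stable_cvg : A_stable A b ->
  exists2 l : R, `|l| <= 1 & stability_fun A b (- x) @[x --> +oo] --> l.
Proof.
move=> hA; have [p [q [q0 pq]]] := stability_funN_ratio A b.
have bnd : \forall x \near +oo, `|stability_fun A b (- x)| <= 1.
  near=> x; apply: A_stable_real => //; rewrite oppr_le0.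
  by near: x; apply: nbhs_pinfty_ge; exact: num_real.
have /cvg_ex[/= l cl] : cvg (stability_fun A b (- x) @[x --> +oo]).
  rewrite (_ : (fun x => _) = (fun x => p.[x] / q.[x])); last exact/funext.
  by apply: (@cvg_bounded_ratio _ p q 1 q0); near=> x; rewrite -pq; near: x.
by exists l => //; apply: (cvgr_to_le (cvg_norm cl) bnd).
Unshelve. all: by end_near. Qed.

(** The factor [c] is the ratio of time steps: [k] for the coarse scheme, 1 for the fine one. *)
Lemma vanishes_at_infinity_cvg (c : R) : 0 < c ->
  vanishes_at_infinity (complex_stability_fun A b) ->
  stability_fun A b (- (c * x)) @[x --> +oo] --> (0 : R).
Proof.
move=> c0 h; apply/cvgr0Pnorm_lt => e /h[M hM]; near=> x.
(* It suffices that [x] exceeds [M / c], whatever the sign of [M], since [c * x] is at most its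
   absolute value. *)
have /hM : M%:C < `|(- (c * x))%:C|.
  rewrite norm_real_complex ltcR normrN (lt_le_trans _ (ler_norm _))//.
  rewrite -ltr_pdivrMl//; near: x; apply: nbhs_pinfty_gt; exact: num_real.
by rewrite complex_stability_fun_real norm_real_complex ltcR.
Unshelve. all: by end_near. Qed.

End RealAxis.

Theorem proposition1 (R : realType) (k : nat) (hk : (2 <= k)%N)
    (s0 s1 : nat) (A0 : 'M[R]_s0) (b0 : 'cV[R]_s0)
    (A1 : 'M[R]_s1) (b1 : 'cV[R]_s1) :
  let lambda := fine_eigenvalue A0 b0 in
  let mu := coarse_eigenvalue k A1 b1 in
  let F (x : R) : R := `|mu x - lambda x ^+ k| / (1 - `|mu x|) in
  let G (x : R) : R :=
    `|lambda x ^+ k| * `|mu x - lambda x ^+ k| / (1 - `|mu x|) in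
  let Lk (x : R) : R := `|lambda x ^+ k| in
  (L_stable A1 b1 -> A_stable A0 b0 ->
    [/\ cvg (F x @[x --> +oo]) /\ lim (F x @[x --> +oo]) <= 1,
        cvg (G x @[x --> +oo]),
        cvg (Lk x @[x --> +oo]),
        lim (G x @[x --> +oo]) <= lim (Lk x @[x --> +oo]) &
        lim (Lk x @[x --> +oo]) <= 1]) /\
  (L_stable A1 b1 -> L_stable A0 b0 ->
    F x @[x --> +oo] --> (0 : R) /\ G x @[x --> +oo] --> (0 : R)).
Proof.
move=> lambda mu F G Lk.
(* Both parts follow from this: [l] comes from A-stability in the first and is 0 in the second. *)
have lims (l : R) : L_stable A1 b1 -> lambda x @[x --> +oo] --> l ->
    [/\ F x @[x --> +oo] --> `|l ^+ k|,
        G x @[x --> +oo] --> `|l ^+ k| * `|l ^+ k| &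
        Lk x @[x --> +oo] --> `|l ^+ k|].
  move=> [_ h1] cl.
  have cmu : mu x @[x --> +oo] --> (0 : R).
    by apply: vanishes_at_infinity_cvg => //; rewrite ltr0n ltnW.
  have clk : lambda x ^+ k @[x --> +oo] --> l ^+ k.
    exact: (cvg_comp _ _ cl (@exprn_continuous _ k l)).
  have cL : Lk x @[x --> +oo] --> `|l ^+ k| by exact: cvg_norm.
  have cF : F x @[x --> +oo] --> `|l ^+ k|.
    (* The limit is put in the shape of [F], with [mu] replaced by 0 and [lambda] by [l]; the
       denominator then tends to 1. *)
    have -> : `|l ^+ k| = `|0 - l ^+ k| / (1 - `|0 : R|).
      by rewrite normr0 subr0 divr1 sub0r normrN.
    apply: cvgM; first by apply: cvg_norm; exact: cvgB.
    apply: cvgV; first by rewrite normr0 subr0 oner_eq0.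
    by apply: cvgB; [exact: cvg_cst|exact: cvg_norm].
  split=> //; rewrite (_ : G = fun x => Lk x * F x); first exact: cvgM.
  by apply/funext => x; rewrite /G /F /Lk mulrA.
split=> [h1 h0|h1 [_ h0]].
  have [l l1 /(lims _ h1)[cF cG cL]] := A_stable_cvg h0.
  have lk1 : `|l ^+ k| <= 1 by rewrite normrX exprn_ile1.
  rewrite !(cvg_lim _ cF, cvg_lim _ cG, cvg_lim _ cL)//.
  (* The comparison of the limits of [G] and [Lk] is [a * a <= a] for [a] in the unit interval. *)
  by split=> //; rewrite ler_piMr.
have /(lims _ h1)[cF cG _] : lambda x @[x --> +oo] --> (0 : R).
  have := vanishes_at_infinity_cvg ltr01 h0.
  by rewrite /lambda /fine_eigenvalue; under eq_fun do rewrite mul1r.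
(* Positivity of [k] matters here, as [0 ^+ 0] is 1. *)
have k0 : `|0 ^+ k : R| = 0 by rewrite expr0n gtn_eqF ?normr0// ltnW.
by move: cF cG; rewrite k0 mulr0.
Qed.
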